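(* A (complex) spin factor is ternary weakly amenable if, and only if, it is finite dimensional.
   Context: A (complex) JB$^*$-triple is a complex Banach space $E$ with a continuous triple product $\{\cdot,\cdot,\cdot\}$, bilinear and symmetric in the outer variables and conjugate linear in the middle one, satisfying $L(a,b)L(x,y)-L(x,y)L(a,b)=L(L(a,b)x,y)-L(x,L(b,a)y)$ (where $L(x,y)z=\{x,y,z\}$), such that each $L(a,a)$ is a hermitian operator with non-negative spectrum and $\|\{a,a,a\}\|=\|a\|^3$. A (complex) spin factor is a complex JB$^*$-triple $A$ which can be equipped with an inner product $(\cdot|\cdot)$ (linear in the first variable) and a conjugation ${}^\sharp$ (a conjugate-linear isometry of period 2, with $(x^\sharp|y^\sharp)=(y|x)$) such that the norm satisfies $\|x\|^2=\frac12\Big((x|x)+\sqrt{(x|x)^2-|(x|x^\sharp)|^2}\Big)$ and the triple product is $\{a,b,c\}=\frac12\big[(a|b)c+(c|b)a-(a|c^\sharp)b^\sharp\big]$. For a complex Jordan Banach triple $E$, the dual $E^*$ is a Jordan triple $E$-module with the products $\{a,b,\varphi\}(x)=\{\varphi,b,a\}(x):=\varphi(\{b,a,x\})$ and $\{a,\varphi,b\}(x):=\overline{\varphi(\{a,x,b\})}$ for $a,b,x\in E$, $\varphi\in E^*$. A ternary derivation $\delta:E\to E^*$ is a conjugate linear map with $\delta\{a,b,c\}=\{\delta(a),b,c\}+\{a,\delta(b),c\}+\{a,b,\delta(c)\}$ for all $a,b,c\in E$. For $b\in E$, $\varphi\in E^*$, the map $\delta(b,\varphi)(a):=\{b,\varphi,a\}-\{\varphi,b,a\}$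 is a ternary derivation; finite sums of such maps are called inner ternary derivations. $E$ is ternary weakly amenable if every continuous ternary derivation $E\to E^*$ is inner. *)

(* Defs.v *)
From HB Require Import structures.
From mathcomp Require Import all_boot all_order all_algebra.
From mathcomp Require Import complex.
From mathcomp Require Import boolp classical_sets functions reals.
From mathcomp Require Import topology normedtype sequences.

Set Implicit Arguments.
Unset Strict Implicit.
Unset Printing Implicit Defensive.

Import Order.TTheory GRing.Theory Num.Theory.
Import numFieldNormedType.Exports.

Local Open Scope classical_set_scope.
Local Open Scope ring_scope.

(** The dual Banach space: continuous linear functionals, with the operator
    norm [`|phi| = sup { |phi x| : `|x| <= 1 }]. As norms over the scalars
    [R[i]] are themselves [R[i]]-valued (real and nonnegative), the supremum is
    taken in [R] and embedded back. *)

Definition continuous_functional (R : realType) (E : normedModType R[i]) :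
    {pred E -> R[i]^o} :=
  [pred f : E -> R[i]^o | `[< linear f /\ continuous f >]].

Arguments continuous_functional {R} E.

Record dualspace (R : realType) (E : normedModType R[i]) := Dual {
  dual_fun :> E -> R[i]^o;
  dual_funP : dual_fun \in continuous_functional E }.

Arguments Dual {R E} dual_fun dual_funP.

Section DualLmodule.
Variables (R : realType) (E : normedModType R[i]).

HB.instance Definition _ := [isSub for @dual_fun R E].
HB.instance Definition _ := [Choice of dualspace E by <:].

Lemma continuous_functionalP (f : E -> R[i]^o) :
  reflect (linear f /\ continuous f) (f \in continuous_functional E).
Proof. exact: asboolP. Qed.

Lemma continuous_functional_submod_closed :
  submod_closed (continuous_functional E).
Proof.
split.
  apply/continuous_functionalP; split.
    by move=> k x y; rewrite /GRing.zero /= scaler0 addr0.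
  exact: cst_continuous.
move=> k f g /continuous_functionalP[lf cf] /continuous_functionalP[lg cg].
apply/continuous_functionalP; split.
  move=> a x y.
  have -> : (k *: f + g) (a *: x + y) =
            k *: f (a *: x + y) + g (a *: x + y) by [].
  by rewrite (lf a x y) (lg a x y) !scalerDr !scalerA (mulrC k) addrACA.
move=> x; apply: (@cvgD _ _ _ (nbhs x)); last exact: cg.
by apply: (@cvgZl_tmp _ _ _ (nbhs x)); exact: cf.
Qed.

HB.instance Definition _ := GRing.isSubmodClosed.Build _ _
  (continuous_functional E) continuous_functional_submod_closed.
HB.instance Definition _ := [SubChoice_isSubLmodule of dualspace E by <:].

End DualLmodule.

Section DualNorm.
Variables (R : realType) (E : normedModType R[i]).
Implicit Types (phi psi : dualspace E) (k : R[i]).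

Lemma dual_linear phi : linear (phi : E -> R[i]^o).
Proof. by have /continuous_functionalP[] := dual_funP phi. Qed.

Lemma dual_continuous phi : continuous (phi : E -> R[i]^o).
Proof. by have /continuous_functionalP[] := dual_funP phi. Qed.

HB.instance Definition _ phi :=
  GRing.isLinear.Build R[i] E R[i]^o *:%R (dual_fun phi) (dual_linear phi).

Lemma dualP phi psi : (forall x, phi x = psi x) -> phi = psi.
Proof. by move=> eq_phi; apply/val_inj/funext. Qed.

Lemma dualDE phi psi x : (phi + psi) x = phi x + psi x.
Proof. by []. Qed.

Lemma dualNE phi x : (- phi) x = - phi x.
Proof. by []. Qed.

Lemma dualZE k phi x : (k *: phi) x = k * phi x.
Proof. by []. Qed.

Definition dual_unit_values phi : set R :=
  [set complex.Re `|phi x| | x in [set x : E | `|x| <= 1]].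

Definition dual_norm phi : R[i] := (sup (dual_unit_values phi))%:C%C.

Lemma Re_norm (V : normedZmodType R[i]) (v : V) :
  (complex.Re `|v|)%:C%C = `|v| :> R[i].
Proof. by rewrite RRe_real// ger0_real. Qed.

Lemma dual_has_sup phi : has_sup (dual_unit_values phi).
Proof.
split; first by exists (complex.Re `|phi 0|), 0; rewrite //= normr0.
have /linear_boundedP : bounded_near (phi : {linear E -> R[i]^o}) (nbhs (0 : E)).
  by apply/linear_bounded_continuous; exact: dual_continuous.
move=> /pinfty_ex_gt0[M M0 phiM].
exists (complex.Re M) => _ [x x1 <-].
rewrite -lecR Re_norm RRe_real ?gtr0_real//.
by rewrite (le_trans (phiM x))// ler_piMr// ltW.
Qed.

Lemma dual_norm_ge0 phi : 0 <= dual_norm phi.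
Proof.
rewrite -[0]/(0%:C)%C lecR.
apply: (@le_trans _ _ (complex.Re `|phi 0|)).
  by rewrite -lecR Re_norm; exact: normr_ge0.
apply: ub_le_sup; first exact: (dual_has_sup phi).2.
by exists 0; rewrite //= normr0.
Qed.

Lemma dual_norm_le phi x : `|phi x| <= dual_norm phi * `|x|.
Proof.
have [->|x0] := eqVneq x 0; first by rewrite linear0 !normr0 mulr0.
have nx : 0 < `|x| by rewrite normr_gt0.
rewrite -ler_pdivrMr//.
have -> : `|phi x| / `|x| = `|phi (`|x|^-1 *: x)|.
  by rewrite linearZ/= normrM normfV normr_id mulrC.
rewrite -Re_norm lecR; apply: ub_le_sup.
  exact: (dual_has_sup phi).2.
by exists (`|x|^-1 *: x); rewrite //= normrZ normfV normr_id mulVf// gt_eqF.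
Qed.

Lemma dual_norm_lub phi (M : R[i]) :
  (forall x, `|x| <= 1 -> `|phi x| <= M) -> dual_norm phi <= M.
Proof.
move=> phiM; have M0 : 0 <= M by rewrite (le_trans _ (phiM 0 _)) ?normr0.
rewrite -(RRe_real (ger0_real M0)) lecR.
apply: ge_sup; first exact: (dual_has_sup phi).1.
move=> _ [x x1 <-].
by rewrite -lecR Re_norm RRe_real ?ger0_real// phiM.
Qed.

Lemma dual_normD phi psi : dual_norm (phi + psi) <= dual_norm phi + dual_norm psi.
Proof.
apply: dual_norm_lub => x x1; rewrite dualDE (le_trans (ler_normD _ _))//.
by apply: lerD; rewrite (le_trans (dual_norm_le _ x))// ler_piMr// dual_norm_ge0.
Qed.

Lemma dual_normZ k phi : dual_norm (k *: phi) = `|k| * dual_norm phi.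
Proof.
have leZ l f : dual_norm (l *: f) <= `|l| * dual_norm f.
  apply: dual_norm_lub => x x1; rewrite dualZE normrM ler_wpM2l//.
  by rewrite (le_trans (dual_norm_le _ x))// ler_piMr// dual_norm_ge0.
apply/eqP; rewrite eq_le leZ/=.
have [->|k0] := eqVneq k 0; first by rewrite normr0 mul0r dual_norm_ge0.
have nk : 0 < `|k| by rewrite normr_gt0.
rewrite -ler_pdivlMl// -normfV (le_trans _ (leZ _ _))//.
by rewrite scalerA mulVf// scale1r.
Qed.

Lemma dual_norm_eq0 phi : dual_norm phi = 0 -> phi = 0.
Proof.
move=> phi0; apply: dualP => x; apply/eqP.
by rewrite -normr_le0 (le_trans (dual_norm_le _ _))// phi0 mul0r.
Qed.

HB.instance Definition _ := Lmodule_isNormed.Build R[i] (dualspace E)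
  dual_normD dual_normZ dual_norm_eq0.

End DualNorm.

(** Symmetry [tprodC] makes [tprod] linear in the third variable as well. *)
HB.mixin Record isJordanBanachTriple (R : realType) E
    of CompleteNormedModule R[i] E := {
  tprod : E -> E -> E -> E;
  tprod_continuous : continuous (fun p : E * E * E => tprod p.1.1 p.1.2 p.2);
  tprodC : forall a b c, tprod a b c = tprod c b a;
  tprod_linear : forall b c, linear (fun a => tprod a b c);
  tprod_conj_linear : forall a c (k : R[i]) b b',
    tprod a (k *: b + b') c = k^* *: tprod a b c + tprod a b' c;
  tprod_jordan : forall a b x y z,
    tprod a b (tprod x y z) - tprod x y (tprod a b z) =
    tprod (tprod a b x) y z - tprod x (tprod b a y) z }.

#[short(type="jordanBanachTripleType")]
HB.structure Definition JordanBanachTriple (R : realType) :=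
  {E of isJordanBanachTriple R E & CompleteNormedModule R[i] E}.

Section Operators.
Variables (R : realType) (E : completeNormedModType R[i]).
Implicit Types (T : E -> E) (l z : R[i]).

Definition bounded_operator T := linear T /\ continuous T.

Definition exp_operator z T (x : E) : E :=
  limn (series (fun n => (z ^+ n / n`!%:R) *: iter n T x)).

(** Kaup's definition of hermitian operators on a Banach space: [exp (i t T)] is
    an isometry for every real [t]. *)
Definition hermitian_operator T :=
  bounded_operator T /\
  forall (t : R) x, `|exp_operator ('i * t%:C%C) T x| = `|x|.

Definition spectrum T : set R[i] :=
  [set l | ~ exists S : E -> E, [/\ bounded_operator S,
     forall x, S (T x - l *: x) = x & forall x, T (S x) - l *: S x = x]].

End Operators.

HB.mixin Record isJBStarTriple (R : realType) E of JordanBanachTriple R E := {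
  tprod_hermitian : forall a : E, hermitian_operator (tprod a a);
  tprod_spectrum_ge0 : forall a : E, spectrum (tprod a a) `<=` [set l | 0 <= l];
  norm_tprod : forall a : E, `|tprod a a a| = `|a| ^+ 3 }.

#[short(type="jbStarTripleType")]
HB.structure Definition JBStarTriple (R : realType) :=
  {E of isJBStarTriple R E & JordanBanachTriple R E}.

Section SpinFactor.
Variables (R : realType) (A : jbStarTripleType R).

(** [{dot A for Num.conj}]: positive definite hermitian forms, linear in the
    first variable. *)
Record spin_structure (ip : {dot A for Num.conj}) (sharp : A -> A) : Prop := {
  sharp_conj_linear : forall (k : R[i]) x y,
    sharp (k *: x + y) = k^* *: sharp x + sharp y;
  sharp_isometry : forall x, `|sharp x| = `|x|;
  sharpK : involutive sharp;
  ip_sharp : forall x y, ip (sharp x) (sharp y) = ip y x;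
  spin_norm : forall x,
    `|x| ^+ 2 = 2^-1 * (ip x x + sqrtC (ip x x ^+ 2 - `|ip x (sharp x)| ^+ 2));
  spin_tprod : forall a b c,
    tprod a b c =
    2^-1 *: (ip a b *: c + ip c b *: a - ip a (sharp c) *: sharp b) }.

Definition spin_factor := exists ip sharp, spin_structure ip sharp.

End SpinFactor.

Arguments spin_factor {R} A.

Section DualModule.
Variables (R : realType) (E : jordanBanachTripleType R).
Implicit Types (a b c x : E) (phi : dualspace E).

Lemma tprod_linearr a b : linear (tprod a b).
Proof.
by move=> k x y; rewrite tprodC tprod_linear (tprodC x) (tprodC y).
Qed.

Lemma tprod_continuousr a b : continuous (tprod a b).
Proof.
move=> x; apply: (@continuous_comp _ _ _ (fun z : E => (a, b, z))
  (fun p : E * E * E => tprod p.1.1 p.1.2 p.2)); last exact: tprod_continuous.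
exact: (cvg_pair (cvg_cst (a, b)) cvg_id).
Qed.

Lemma tprod_continuousm a c : continuous (fun b => tprod a b c).
Proof.
move=> x; apply: (@continuous_comp _ _ _ (fun z : E => (a, z, c))
  (fun p : E * E * E => tprod p.1.1 p.1.2 p.2)); last exact: tprod_continuous.
exact: (cvg_pair (cvg_pair (cvg_cst a) cvg_id) (cvg_cst c)).
Qed.

Lemma conj_continuous : continuous (fun z : R[i]^o => z^* : R[i]^o).
Proof.
move=> z; apply/(@cvgrPdist_lt _ _ _ (nbhs z)) => e e0; near=> w.
rewrite -rmorphB norm_conjC.
by near: w; exact: (@cvgr_dist_lt _ _ _ (nbhs z) _ id).
Unshelve. all: by end_near. Qed.

Lemma dact_outer_subproof a b phi :
  (fun x => phi (tprod b a x)) \in continuous_functional E.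
Proof.
apply/continuous_functionalP; split.
  by move=> k x y; rewrite tprod_linearr linearP.
move=> x; apply: (@continuous_comp _ _ _ (tprod b a) phi).
  exact: tprod_continuousr.
exact: dual_continuous.
Qed.

Lemma dact_mid_subproof a phi b :
  (fun x => (phi (tprod a x b))^*) \in continuous_functional E.
Proof.
apply/continuous_functionalP; split.
  have conjZ (C : numClosedFieldType) (k z : C) : (k^* * z)^* = k * z^*.
    by rewrite rmorphM /= conjCK.
  move=> k x y; rewrite tprod_conj_linear linearP rmorphD.
  by congr (_ + _); exact: (conjZ R[i]).
move=> x; apply: (@continuous_comp _ _ _ (fun x => phi (tprod a x b)) Num.conj).
  apply: (@continuous_comp _ _ _ (fun x => tprod a x b) phi).
    exact: tprod_continuousm.
  exact: dual_continuous.
exact: conj_continuous.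
Qed.

(** The module products [{a, b, phi}], [{phi, b, a}] and [{a, phi, b}]. *)
Definition dact_r a b phi : dualspace E :=
  Dual (fun x => phi (tprod b a x)) (dact_outer_subproof a b phi).

Definition dact_l phi b a : dualspace E := dact_r a b phi.

Definition dact_m a phi b : dualspace E :=
  Dual (fun x => (phi (tprod a x b))^*) (dact_mid_subproof a phi b).

Record ternary_derivation (delta : E -> dualspace E) : Prop := {
  ternary_derivation_conj_linear : forall (k : R[i]) a b,
    delta (k *: a + b) = k^* *: delta a + delta b;
  ternary_derivation_tprod : forall a b c,
    delta (tprod a b c) =
    dact_l (delta a) b c + dact_m a (delta b) c + dact_r a b (delta c) }.

Definition inner_derivation b phi a : dualspace E :=
  dact_m b phi a - dact_l phi b a.

Definition inner_ternary_derivation (delta : E -> dualspace E) :=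
  exists n (b : 'I_n -> E) (phi : 'I_n -> dualspace E),
    forall a, delta a = \sum_(j < n) inner_derivation (b j) (phi j) a.

Definition ternary_weakly_amenable :=
  forall delta : E -> dualspace E,
    ternary_derivation delta -> continuous delta ->
    inner_ternary_derivation delta.

End DualModule.

Arguments ternary_weakly_amenable {R} E.

Definition finite_dimensional (K : fieldType) (V : lmodType K) :=
  exists n, inhabited (Vector.axiom n V).

(* Main.v *)
Require Import Defs.
From mathcomp Require Import all_boot all_order all_algebra.
From mathcomp Require Import complex.
From mathcomp Require Import boolp classical_sets functions reals.
From mathcomp Require Import topology normedtype sequences.
From mathcomp Require Import zify ring.

Set Implicit Arguments.
Unset Strict Implicit.
Unset Printing Implicit Defensive.

Import Order.TTheory GRing.Theory Num.Theory.
Import numFieldNormedType.Exports.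

Local Open Scope classical_set_scope.
Local Open Scope ring_scope.

(** Let [H] be the Hilbert space given by [ip], whose norm is equivalent to the
    spin norm. Under [u |-> ip^~ u] the module products of the dual become the
    triple products of [H], so ternary derivations with values in the dual
    correspond to linear maps [D] that are derivations of the triple product.
    Every bounded skew-hermitian [D] commuting with [sharp] is such a derivation
    ([skew_ternary_derivation]), whereas an inner one is an imaginary multiple of
    the identity plus an operator of finite rank.

    Gram-Schmidt among the vectors fixed by [sharp] produces either a finite
    orthonormal basis or an infinite orthonormal sequence of such vectors
    ([real_basis_or_sequence]); this dichotomy decides whether the spin factor is
    finite dimensional, and each branch settles amenability.

    With a finite basis [e], write [m l k = delta (e k) (e l)]. The derivation
    identity on basis vectors ([derivation_matrix]) forces [m] to be a real
    antisymmetric matrix plus one imaginary scalar [t] times the identity. Such a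
    matrix is the matrix of [\sum_j inner_derivation (e j) (phi j)], where
    [phi j] is [- 2^-1 *: delta (e j)] corrected by a multiple of [ip^~ (e j)]
    that adjusts the trace, and a conjugate linear map is determined by its
    matrix.

    With an infinite sequence [e], let [D] be the sum over [n] of the quarter
    turns of the planes spanned by [e (2n)] and [e (2n+1)], with weights [2^-n]
    making the series converge. It is bounded, skew and commutes with [sharp]. Its
    matrix from the even to the odd vectors is diagonal with nonzero entries, so
    its finite blocks have arbitrarily large rank; but the scalar part of an
    inner derivation does not contribute to these entries, and the blocks of a sum
    of [m] inner derivations have rank at most [4 m]
    ([inner_block_rank_le]). *)

(** * Geometrically bounded series in complex Banach spaces *)

Section GeometricSeries.
Variables (R : realType) (V : completeNormedModType R[i]).
Implicit Types (C e : R[i]) (u : V ^nat).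

(** The bounds live in [R[i]], which is only partially ordered; the quotient of
    two nonnegative elements is real, where the archimedean property applies. *)
Lemma near_geometric_lt C e : 0 <= C -> 0 < e ->
  \forall n \near \oo, C * 2^-1 ^+ n < e.
Proof.
move=> C0 e0.
have r0 : 0 <= C / e by rewrite divr_ge0// ltW.
pose r := complex.Re (C / e).
have rE : C / e = r%:C%C by rewrite RRe_real// ger0_real.
near=> n.
have -> : C * 2^-1 ^+ n = e * (C / e / 2 ^+ n).
  by rewrite exprVn; field; rewrite expf_neq0//= gt_eqF.
rewrite gtr_pMr// ltr_pdivrMr ?exprn_gt0// mul1r rE.
have -> : (2 : R[i]) ^+ n = (2 ^+ n)%:C%C by rewrite rmorphXn/= rmorph_nat.
rewrite ltcR; apply: upper_nthrootP.
by near: n; exists (Num.bound r).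
Unshelve. all: by end_near. Qed.

Lemma geometric_tail_le C u m n : 0 <= C ->
  (forall k, `|u k| <= C * 2^-1 ^+ k) ->
  `|\sum_(m <= k < n) u k| <= C * 2 * 2^-1 ^+ m.
Proof.
move=> C0 uC; have [mn|/ltnW nm] := leqP m n; last first.
  by rewrite big_geq// normr0 !mulr_ge0 ?exprn_ge0 ?invr_ge0 ?ler0n.
suff : `|\sum_(m <= k < n) u k| <= C * 2 * (2^-1 ^+ m - 2^-1 ^+ n).
  move=> le_u; apply: (le_trans le_u).
  by rewrite ler_wpM2l ?mulr_ge0 ?ler0n// gerBl exprn_ge0 ?invr_ge0 ?ler0n.
elim: n mn => [|n IHn].
  by rewrite leqn0 => /eqP->; rewrite big_geq// normr0 subrr mulr0.
rewrite leq_eqVlt => /predU1P[->|].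
  by rewrite big_geq// normr0 subrr mulr0.
rewrite ltnS => mn; rewrite big_nat_recr//= (le_trans (ler_normD _ _))//.
rewrite (le_trans (lerD (IHn mn) (uC n)))// le_eqVlt; apply/orP; left.
by apply/eqP; rewrite exprS; field.
Qed.

Lemma geometric_series_cvg C u : 0 <= C ->
  (forall k, `|u k| <= C * 2^-1 ^+ k) -> cvgn (series u).
Proof.
move=> C0 uC; apply/cauchy_cvgP/cauchy_seriesP => e e0.
have C20 : 0 <= C * 2 by rewrite mulr_ge0 ?ler0n.
have [N _ NC] := near_geometric_lt C20 e0.
exists ([set n | (N <= n)%N], [set: nat]) => /=.
  by split; [exists N|exact: filterT].
move=> [m n] [/= Nm _]; apply: le_lt_trans (NC _ Nm).
exact: geometric_tail_le.
Qed.

(** Comparison of limits in the partially ordered [R[i]]: arguing up to each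
    positive [e] avoids any totality. *)
Lemma cvgn_norm_le (v : V ^nat) l M : (forall n, `|v n| <= M) ->
  v n @[n --> \oo] --> l -> `|l| <= M.
Proof.
move=> vM vl; apply/ler_addgt0Pr => e e0.
have /cvgrPdist_le /(_ e e0)[N _ /(_ N (leqnn N))/= vN] := vl.
rewrite addrC -(subrK (v N) l) (le_trans (ler_normD _ _))// lerD//.
Qed.

Lemma geometric_series_norm C u : 0 <= C ->
  (forall k, `|u k| <= C * 2^-1 ^+ k) -> `|limn (series u)| <= C * 2.
Proof.
move=> C0 uC; apply: (cvgn_norm_le _ (geometric_series_cvg C0 uC)) => n.
by rewrite (le_trans (geometric_tail_le 0 n C0 uC))// expr0 mulr1.
Qed.

End GeometricSeries.

(** * Geometry of a spin factor *)

Section SpinGeometry.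
Variables (R : realType) (A : jbStarTripleType R).
Variables (ip : {dot A for Num.conj}) (sharp : A -> A).
Hypothesis spinA : spin_structure ip sharp.
Implicit Types (x y z u v : A) (k : R[i]).

Lemma ipC x y : ip x y = (ip y x)^*.
Proof. by rewrite hermC expr0 mul1r. Qed.

Lemma ip_ge0 x : 0 <= ip x x. Proof. exact: dnorm_ge0. Qed.

Lemma ip_eq0 x : (ip x x == 0) = (x == 0). Proof. exact: dnorm_eq0. Qed.

Lemma ipZl k x y : ip (k *: x) y = k * ip x y.
Proof. by rewrite linearZl_LR. Qed.

Lemma ipZr k x y : ip x (k *: y) = k^* * ip x y.
Proof. by rewrite linearZr_LR. Qed.

Lemma ipDl x y z : ip (x + y) z = ip x z + ip y z.
Proof. by rewrite linearDl. Qed.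

Lemma ipDr x y z : ip x (y + z) = ip x y + ip x z.
Proof. by rewrite linearDr. Qed.

Lemma ipBl x y z : ip (x - y) z = ip x z - ip y z.
Proof. by rewrite linearBl. Qed.

Lemma ipBr x y z : ip x (y - z) = ip x y - ip x z.
Proof. by rewrite linearBr. Qed.

Lemma ip0l x : ip 0 x = 0. Proof. by rewrite linear0l. Qed.
Lemma ip0r x : ip x 0 = 0. Proof. by rewrite linear0r. Qed.

Lemma ip_suml I (s : seq I) (F : I -> A) y :
  ip (\sum_(i <- s) F i) y = \sum_(i <- s) ip (F i) y.
Proof. exact: (big_morph (ip^~ y) (fun a b => ipDl a b y) (ip0l y)). Qed.

Lemma ip_sumr I (s : seq I) (F : I -> A) y :
  ip y (\sum_(i <- s) F i) = \sum_(i <- s) ip y (F i).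
Proof. exact: (big_morph (ip y) (ipDr y) (ip0r y)). Qed.

(** The component of [x] orthogonal to [y], here scaled by [ip y y], has a
    nonnegative square. *)
Lemma ip_CauchySchwarz x y : `|ip x y| ^+ 2 <= ip x x * ip y y.
Proof.
have [->|y0] := eqVneq y 0; first by rewrite !ip0r normr0 expr0n/= mulr0.
have yy : 0 < ip y y by rewrite lt_def ip_eq0 y0 ip_ge0.
pose z := ip y y *: x - ip x y *: y.
have : 0 <= ip y y * (ip x x * ip y y - `|ip x y| ^+ 2).
  suff <- : ip z z = ip y y * (ip x x * ip y y - `|ip x y| ^+ 2).
    exact: ip_ge0.
  rewrite normCK /z ipBl !ipBr !ipZl !ipZr (geC0_conj (ip_ge0 y)) (ipC y x).
  by ring.
by rewrite pmulr_rge0// subr_ge0.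
Qed.

Lemma sharpD x y : sharp (x + y) = sharp x + sharp y.
Proof.
by have := sharp_conj_linear spinA 1 x y; rewrite !scale1r rmorph1 scale1r.
Qed.

Lemma sharp0 : sharp 0 = 0.
Proof. by apply: (@addrI _ (sharp 0)); rewrite -sharpD !addr0. Qed.

Lemma sharpZ k x : sharp (k *: x) = k^* *: sharp x.
Proof. by have := sharp_conj_linear spinA k x 0; rewrite sharp0 !addr0. Qed.

Lemma sharpB x y : sharp (x - y) = sharp x - sharp y.
Proof. by rewrite -scaleN1r sharpD sharpZ rmorphN1 scaleN1r. Qed.

Lemma sharp_sum I (s : seq I) (F : I -> A) :
  sharp (\sum_(i <- s) F i) = \sum_(i <- s) sharp (F i).
Proof. exact: (big_morph sharp sharpD sharp0). Qed.

Lemma ip_sharpl x y : ip (sharp x) y = (ip x (sharp y))^*.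
Proof. by rewrite -{1}(sharpK spinA y) (ip_sharp spinA) -ipC. Qed.

(** Cauchy-Schwarz makes the radicand of the spin norm nonnegative. *)
Lemma spin_radical_bounds x (s := ip x x ^+ 2 - `|ip x (sharp x)| ^+ 2) :
  0 <= sqrtC s <= ip x x.
Proof.
have ipx2 : 0 <= ip x x ^+ 2 by rewrite exprn_ge0// ip_ge0.
have s0 : 0 <= s.
  by rewrite subr_ge0 (le_trans (ip_CauchySchwarz _ _))// (ip_sharp spinA) expr2.
rewrite sqrtC_ge0 s0/= -[leRHS](sqrCK (ip_ge0 x)) ler_sqrtC ?nnegrE//.
by rewrite gerBl exprn_ge0.
Qed.

(** With [norm_le_ip], the spin norm and the Hilbert norm are equivalent, so that
    continuity may be checked in either. *)
Lemma ip_le_norm x : ip x x <= 2 * `|x| ^+ 2.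
Proof.
have /andP[s0 _] := spin_radical_bounds x.
by rewrite (spin_norm spinA) mulrA divff ?pnatr_eq0// mul1r lerDl.
Qed.

Lemma norm_le_ip x : `|x| ^+ 2 <= ip x x.
Proof.
have /andP[_ s1] := spin_radical_bounds x.
rewrite (spin_norm spinA) -ler_pdivlMl ?invr_gt0 ?ltr0n// invrK mulr_natl mulr2n.
by rewrite lerD2l.
Qed.

Lemma norm_ip_le x y : `|ip x y| <= 2 * `|x| * `|y|.
Proof.
rewrite -(@ler_pXn2r _ 2)// ?nnegrE ?mulr_ge0 ?ler0n//.
apply: le_trans (ip_CauchySchwarz x y) _.
have -> : (2 * `|x| * `|y|) ^+ 2 = (2 * `|x| ^+ 2) * (2 * `|y| ^+ 2) by ring.
by apply: ler_pM; rewrite ?ip_ge0 ?ip_le_norm.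
Qed.

Lemma unit_norm_le1 x : ip x x = 1 -> `|x| <= 1.
Proof.
move=> x1; rewrite -(@ler_pXn2r _ 2)// ?nnegrE//.
by rewrite expr1n -x1 norm_le_ip.
Qed.

Lemma ip_linear u : linear (fun x => ip x u : R[i]^o).
Proof. by move=> k x y; rewrite ipDl ipZl. Qed.

Lemma ip_functional u : (fun x => ip x u : R[i]^o) \in continuous_functional A.
Proof.
apply/continuous_functionalP; split; first exact: ip_linear.
move=> x; apply/(@cvgrPdist_le _ _ _ (nbhs x)) => e e0.
have C0 : 0 < 2 * (`|u| + 1) by rewrite mulr_gt0 ?ltr0n// ltr_wpDl ?ltr01.
near=> y; rewrite -ipBl (le_trans (norm_ip_le _ _))//.
rewrite mulrAC (@le_trans _ _ (2 * (`|u| + 1) * `|x - y|))//.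
  by rewrite ler_wpM2r// ler_wpM2l ?ler0n// lerDl ler01.
rewrite -ler_pdivlMl// mulrC.
by near: y; apply: (@cvgr_dist_le _ _ _ (nbhs x) _ id) => //; rewrite divr_gt0.
Unshelve. all: by end_near. Qed.

(** The Riesz representation, conjugate linear in [u]. *)
Definition ip_dual u : dualspace A := Dual _ (ip_functional u).

Lemma ip_dualE u x : ip_dual u x = ip x u. Proof. by []. Qed.

Lemma ip_dual_norm u : `|ip_dual u| <= 2 * `|u|.
Proof.
apply: dual_norm_lub => x x1; rewrite (le_trans (norm_ip_le _ _))//.
by rewrite ler_wpM2r// ler_piMr ?ler0n.
Qed.

End SpinGeometry.

(** * Real orthonormal systems *)

Section RealOrthonormal.
Variables (R : realType) (A : jbStarTripleType R).
Variables (ip : {dot A for Num.conj}) (sharp : A -> A).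
Hypothesis spinA : spin_structure ip sharp.
Implicit Types (x y z u v : A) (k : R[i]).

Definition real_orthonormal (I : eqType) (e : I -> A) :=
  (forall i, sharp (e i) = e i) /\ (forall i j, ip (e i) (e j) = (i == j)%:R).

Definition real_basis n (e : 'I_n -> A) :=
  real_orthonormal e /\ forall x, x = \sum_i ip x (e i) *: e i.

Definition real_extension (s : seq A) v :=
  [/\ sharp v = v, ip v v = 1 & forall u, u \in s -> ip v u = 0].

(** Orthonormal families are grown at the head of a list, which makes an infinite
    one the iteration of a single choice of extension. *)
Fixpoint real_orthonormal_seq (s : seq A) : Prop :=
  if s is v :: s' then real_extension s' v /\ real_orthonormal_seq s' else True.

Lemma real_orthonormal_nth s : real_orthonormal_seq s ->
  real_orthonormal (fun i : 'I_(size s) => nth 0 s i).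
Proof.
move=> so; suff nth_so : (forall i, (i < size s)%N -> sharp s`_i = s`_i) /\
    (forall i j, (i < size s)%N -> (j < size s)%N ->
      ip s`_i s`_j = (i == j)%:R).
  by split=> [i|i j]; [apply: nth_so.1|rewrite nth_so.2].
elim: s so => [|v s IHs] /=; first by split=> [[]|[]].
move=> [[vr v1 vs] /IHs[sr ss]]; split; first by move=> [|i] //= /sr.
move=> [|i] [|j] //= si sj; last exact: ss.
  by rewrite vs ?mem_nth.
by rewrite (ipC ip) vs ?mem_nth// rmorph0.
Qed.

Lemma real_extension_normalize s x : sharp x = x -> x != 0 ->
  (forall u, u \in s -> ip x u = 0) -> exists v, real_extension s v.
Proof.
move=> xr x0 xs; pose c := (sqrtC (ip x x))^-1.
have c0 : 0 <= c by rewrite invr_ge0 sqrtC_ge0 ip_ge0.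
exists (c *: x); split=> [||u us].
- by rewrite (sharpZ spinA) xr geC0_conj.
- rewrite ipZl ipZr geC0_conj// mulrA -expr2 exprVn sqrtCK mulVf//.
  by rewrite ip_eq0.
- by rewrite ipZl xs ?mulr0.
Qed.

(** The part [y] of [x] orthogonal to a maximal system vanishes: [y + sharp y] and
    ['i *: (y - sharp y)] are real and still orthogonal to the system, so either
    one, if nonzero, could be normalized and added. *)
Lemma maximal_real_basis s : real_orthonormal_seq s ->
  (forall v, ~ real_extension s v) ->
  real_basis (fun i : 'I_(size s) => nth 0 s i).
Proof.
move=> so smax; have [er eo] := real_orthonormal_nth so; split=> // x.
set p := \sum_i _; pose y := x - p.
have yo u : u \in s -> ip y u = 0.
  move=> /(nthP 0)[i si <-].
  have -> : s`_i = s`_(Ordinal si) by [].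
  move: (Ordinal si) => {si}i.
  rewrite /y ipBl /p (ip_suml ip) (bigD1 i)//= big1 => [|j ji].
    by rewrite ipZl eo eqxx mulr1 addr0 subrr.
  by rewrite ipZl eo (negPf ji) mulr0.
have yso u : u \in s -> ip (sharp y) u = 0.
  move=> us; rewrite (ip_sharpl spinA); move: us => /(nthP 0)[i si <-].
  by rewrite (er (Ordinal si)) yo ?mem_nth// rmorph0.
have ysK := sharpK spinA y.
have real0 z : sharp z = z -> (forall u, u \in s -> ip z u = 0) -> z = 0.
  move=> zr zo; apply: contrapT => /eqP z0.
  by have [v] := real_extension_normalize zr z0 zo; exact: smax.
have yp : y + sharp y = 0.
  apply: real0 => [|u us]; last by rewrite ipDl yo// yso// addr0.
  by rewrite (sharpD spinA) ysK addrC.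
have ym : 'i *: (y - sharp y) = 0.
  apply: real0 => [|u us]; last by rewrite ipZl ipBl yo// yso// subrr mulr0.
  rewrite (sharpZ spinA) (sharpB spinA) ysK conjCi.
  by rewrite -opprB scalerN scaleNr opprK.
have /eqP : y = 0.
  have ym' : y - sharp y = 0.
    by apply/eqP; move/eqP: ym; rewrite scaler_eq0 (negPf (neq0Ci _)).
  have : 2 *: y = 0.
    transitivity ((y + sharp y) + (y - sharp y)); last by rewrite yp ym' addr0.
    by rewrite addrACA subrr addr0 scaler_nat mulr2n.
  by move/eqP; rewrite scaler_eq0 pnatr_eq0/= => /eqP.
by rewrite subr_eq0 => /eqP.
Qed.

(** Gram-Schmidt: if every finite real orthonormal list extends, the iterated
    extension is an infinite orthonormal sequence; a list that does not extend is
    a basis. *)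
Lemma real_basis_or_sequence :
  (exists n (e : 'I_n -> A), real_basis e) \/
  exists e : nat -> A, real_orthonormal e.
Proof.
have [ext|] := pselect (forall s, real_orthonormal_seq s ->
    exists v, real_extension s v); last first.
  move=> /existsNP[s /not_implyP[so /forallNP smax]].
  by left; exists (size s), (fun i => nth 0 s i); exact: maximal_real_basis.
right; have [f fP] : exists f : seq A -> A, forall s,
    real_orthonormal_seq s -> real_extension s (f s).
  have h s : exists v, real_orthonormal_seq s -> real_extension s v.
    have [/ext[v sv]|so] := pselect (real_orthonormal_seq s); first by exists v.
    by exists 0.
  by exists (fun s => projT1 (cid (h s))) => s; exact: (projT2 (cid (h s))).
pose S n := iter n (fun s => f s :: s) [::].
have So n : real_orthonormal_seq (S n).
  by elim: n => //= n IHn; split=> //; exact: fP.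
pose e n := f (S n).
have eS i n : (i < n)%N -> e i \in S n.
  elim: n => // n IHn; rewrite ltnS leq_eqVlt inE => /predU1P[->|/IHn ->].
    by rewrite eqxx.
  by rewrite orbT.
exists e; split=> [i|i j]; first by have [] := fP _ (So i).
have [ij|ji|->] := ltngtP i j.
- by rewrite (ipC ip); have [_ _ ->] := fP _ (So j); rewrite ?eS// rmorph0.
- by have [_ _ ->] := fP _ (So i); rewrite ?eS.
- by have [_ ->] := fP _ (So j).
Qed.

Lemma real_basis_finite_dimensional n (e : 'I_n -> A) :
  real_basis e -> finite_dimensional A.
Proof.
move=> [[er eo] ebasis]; exists n; constructor.
exists (fun x => \row_j ip x (e j)).
  by move=> k x y; apply/rowP => j; rewrite !mxE ipDl ipZl.
exists (fun r : 'rV_n => \sum_j r 0 j *: e j) => [x|r].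
  by under eq_bigr do rewrite mxE; rewrite -ebasis.
apply/rowP => j; rewrite mxE (ip_suml ip) (bigD1 j)//= big1 => [|i ij].
  by rewrite ipZl eo eqxx mulr1 addr0.
by rewrite ipZl eo (negPf ij) mulr0.
Qed.

(** Orthonormal vectors are independent, so their images are [n.+1] independent
    rows of length [n]. *)
Lemma real_sequence_not_finite_dimensional (e : nat -> A) :
  real_orthonormal e -> ~ finite_dimensional A.
Proof.
move=> [er eo] [n [[f flin [g fK gK]]]].
have f0 : f 0 = 0.
  by have := flin (-1) 0 0; rewrite scaler0 addr0 scaleN1r addNr.
pose M := \matrix_(i < n.+1) f (e i).
suff : row_free M.
  by rewrite -row_leq_rank => /leq_trans/(_ (rank_leq_col _)); rewrite ltnn.
apply: inj_row_free => r rM.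
have fsum : f (\sum_i r 0 i *: e i) = 0.
  rewrite -rM mulmx_sum_row; elim/big_rec2: _ => // i y x _ <-.
  by rewrite flin rowK.
have /(congr1 (fun x => ip x _)) sum0 : \sum_i r 0 i *: e i = 0.
  by rewrite -[LHS]fK fsum -f0 fK.
apply/rowP => j; have := sum0 (e j).
rewrite (ip_suml ip) ip0l mxE (bigD1 j)//= big1 => [|i ij].
  by rewrite ipZl eo eqxx mulr1 addr0.
by rewrite ipZl eo (inj_eq val_inj) (negPf ij) mulr0.
Qed.

End RealOrthonormal.

(** * Conjugate linear maps and functionals *)

Section ConjLinear.
Variables (R : realType) (U V : lmodType R[i]) (f : U -> V).
Hypothesis f_conj : forall (k : R[i]) x y, f (k *: x + y) = k^* *: f x + f y.

Lemma conj_linearD x y : f (x + y) = f x + f y.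
Proof. by have := f_conj 1 x y; rewrite !scale1r rmorph1 scale1r. Qed.

Lemma conj_linear0 : f 0 = 0.
Proof. by apply: (@addrI _ (f 0)); rewrite -conj_linearD !addr0. Qed.

Lemma conj_linearZ k x : f (k *: x) = k^* *: f x.
Proof. by have := f_conj k x 0; rewrite conj_linear0 !addr0. Qed.

Lemma conj_linearB x y : f (x - y) = f x - f y.
Proof. by rewrite -scaleN1r conj_linearD conj_linearZ rmorphN1 scaleN1r. Qed.

Lemma conj_linear_sum I (s : seq I) (F : I -> U) :
  f (\sum_(i <- s) F i) = \sum_(i <- s) f (F i).
Proof. exact: (big_morph f conj_linearD conj_linear0). Qed.

End ConjLinear.

Section DualEvaluation.
Variables (R : realType) (E : normedModType R[i]).

Lemma dualD (phi : dualspace E) x y : phi (x + y) = phi x + phi y.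
Proof. exact: linearD. Qed.

Lemma dualB (phi : dualspace E) x y : phi (x - y) = phi x - phi y.
Proof. exact: linearB. Qed.

Lemma dualZ (phi : dualspace E) k x : phi (k *: x) = k * phi x.
Proof. exact: linearZ. Qed.

Lemma dual_sum (phi : dualspace E) I (s : seq I) (F : I -> E) :
  phi (\sum_(i <- s) F i) = \sum_(i <- s) phi (F i).
Proof. exact: linear_sum. Qed.

Lemma dual_sumE I (s : seq I) (F : I -> dualspace E) (x : E) :
  (\sum_(i <- s) F i) x = \sum_(i <- s) F i x.
Proof.
exact: (big_morph (fun f : dualspace E => f x) (fun f g => dualDE f g x)).
Qed.

End DualEvaluation.

Section InnerDerivations.
Variables (R : realType) (E : jordanBanachTripleType R).

Lemma inner_derivationE (b a x : E) (phi : dualspace E) :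
  inner_derivation b phi a x = (phi (tprod b x a))^* - phi (tprod b a x).
Proof. by []. Qed.

Lemma inner_derivation_conj_linear (b : E) (phi : dualspace E) k x y :
  inner_derivation b phi (k *: x + y) =
  k^* *: inner_derivation b phi x + inner_derivation b phi y.
Proof.
apply: dualP => z; rewrite [RHS]dualDE dualZE !inner_derivationE.
rewrite tprod_linearr tprod_conj_linear !dualD !dualZ rmorphD rmorphM/=.
by ring.
Qed.

End InnerDerivations.

Section SpinTriple.
Variables (R : realType) (A : jbStarTripleType R).
Variables (ip : {dot A for Num.conj}) (sharp : A -> A).
Hypothesis spinA : spin_structure ip sharp.

Lemma tprod_orthonormal (I : eqType) (e : I -> A) i j k :
  real_orthonormal ip sharp e ->
  tprod (e i) (e j) (e k) = 2^-1 *: ((i == j)%:R *: e k + (j == k)%:R *: e i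
                                     - (i == k)%:R *: e j).
Proof.
by move=> [er eo]; rewrite (spin_tprod spinA) !er !eo (eq_sym k j).
Qed.

Section Matrix.
Variables (I : eqType) (e : I -> A) (delta : A -> dualspace A).
Hypothesis e_orth : real_orthonormal ip sharp e.
Hypothesis delta_der : ternary_derivation delta.
Let m l k : R[i] := delta (e k) (e l).

(** The derivation identity for [e i], [e j], [e k] evaluated at [e l]. Its three
    instances with at most two distinct indices below determine the shape of
    [m]. *)
Lemma derivation_matrix i j k l :
  (i == j)%:R * m l k + (j == k)%:R * m l i - (i == k)%:R * m l j =
  ((j == k)%:R * m l i + (k == l)%:R * m j i - (j == l)%:R * m k i) +
  ((i == l)%:R * m k j + (k == l)%:R * m i j - (i == k)%:R * m l j)^* +
  ((i == j)%:R * m l k + (i == l)%:R * m j k - (j == l)%:R * m i k).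
Proof.
have dconj := ternary_derivation_conj_linear delta_der.
have dtri i' j' k' (phi : dualspace A) :
    phi (tprod (e i') (e j') (e k')) = 2^-1 * ((i' == j')%:R * phi (e k')
      + (j' == k')%:R * phi (e i') - (i' == k')%:R * phi (e j')).
  by rewrite tprod_orthonormal// dualZ dualB dualD !dualZ.
have /(congr1 (fun phi : dualspace A => phi (e l))) :=
  ternary_derivation_tprod delta_der (e i) (e j) (e k).
rewrite 2!dualDE /= !dtri tprod_orthonormal//.
rewrite (conj_linearZ dconj) (conj_linearB dconj) (conj_linearD dconj).
rewrite !(conj_linearZ dconj) !rmorph_nat fmorphV rmorph_nat dualZE dualDE dualNE.
rewrite dualDE !dualZE -/(m _ _) rmorphM fmorphV rmorph_nat /= -!mulrDr.
rewrite (eq_sym l k) (eq_sym j i).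
move=> /(mulfI _) -> //; last by rewrite invr_eq0 pnatr_eq0.
Qed.

Lemma derivation_matrix_diag j : (m j j)^* = - m j j.
Proof.
have := derivation_matrix j j j j; rewrite !eqxx !mul1r !addrK => mj.
apply: (addIr (m j j)); apply: (addrI (m j j)).
by rewrite addrA -mj addNr addr0.
Qed.

(** The indices [(i, j, i, i)] give [- m i j = 2 m j i + (m i j)^*]; hence [m j i] is
    a real multiple of the real number [m i j + (m i j)^*], and exchanging [i] and [j]
    makes both entries real. *)
Lemma derivation_matrix_offdiag p q : p != q ->
  (m p q)^* = m p q /\ m q p = - m p q.
Proof.
have off i j : i != j -> - m i j = m j i + (m i j)^* + m j i.
  move=> ij; have := derivation_matrix i j i i.
  rewrite !eqxx (eq_sym j i) (negPf ij) !mul0r !mul1r.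
  by rewrite ?(add0r, addr0, sub0r, subr0) addrK.
have half i j : i != j -> m j i = - 2^-1 * (m i j + (m i j)^*).
  by move=> /off mij; rewrite -[X in X + _]opprK mij; field.
have self i j : i != j -> (m j i)^* = m j i.
  move=> /half ->; rewrite rmorphM rmorphN fmorphV rmorph_nat rmorphD/= conjCK.
  by rewrite [_^* + _]addrC.
move=> pq; have mpq : (m p q)^* = m p q by apply: self; rewrite eq_sym.
by split=> //; rewrite (half p q)// mpq; field.
Qed.

Lemma derivation_matrix_diag_const p q : m p p = m q q.
Proof.
have [->//|pq] := eqVneq p q.
have := derivation_matrix p q p q.
rewrite !eqxx (eq_sym q p) (negPf pq) !mul0r !mul1r.
rewrite ?(add0r, addr0, sub0r, subr0) rmorphN/= derivation_matrix_diag => mpq.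
have -> : m p p = 2^-1 * (m q q - (- m p p - - m q q - m p p)) by field.
by rewrite -mpq; field.
Qed.

End Matrix.
End SpinTriple.

(** * Ternary derivations of finite dimensional spin factors *)

Section FiniteDimension.
Variables (R : realType) (A : jbStarTripleType R).
Variables (ip : {dot A for Num.conj}) (sharp : A -> A).
Hypothesis spinA : spin_structure ip sharp.

Lemma conj_linear_eq_on_basis n (e : 'I_n -> A) (f g : A -> dualspace A) :
  real_basis ip sharp e ->
  (forall k x y, f (k *: x + y) = k^* *: f x + f y) ->
  (forall k x y, g (k *: x + y) = k^* *: g x + g y) ->
  (forall i j, f (e i) (e j) = g (e i) (e j)) -> f = g.
Proof.
move=> [_ ebasis] fconj gconj fg; apply/funext => a; apply: dualP => x.
rewrite (ebasis x) !dual_sum; apply: eq_bigr => j _; rewrite !dualZ.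
congr (_ * _); rewrite (ebasis a).
rewrite (conj_linear_sum fconj) (conj_linear_sum gconj).
rewrite !dual_sumE; apply: eq_bigr => i _.
by rewrite (conj_linearZ fconj) (conj_linearZ gconj) !dualZE fg.
Qed.

(** The contribution of [j] is supported on row [j], column [j] and the diagonal,
    so summing over [j] antisymmetrizes twice the real part of [p] and adds a
    trace to the diagonal. *)
Lemma inner_sum_matrix n (e : 'I_n -> A) (phi : 'I_n -> dualspace A) k l
    (p := fun i j : 'I_n => phi j (e i) : R[i]) :
  real_orthonormal ip sharp e ->
  2 * (\sum_j inner_derivation (e j) (phi j) (e k)) (e l) =
  (p k l)^* - (p l k)^* - p l k + p k l +
    (l == k)%:R * \sum_j ((p j j)^* - p j j).
Proof.
move=> eo; rewrite dual_sumE mulr_sumr.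
under eq_bigr => j _.
  rewrite inner_derivationE !(tprod_orthonormal spinA)//.
  rewrite !dualZ !dualB !dualD !dualZ.
  rewrite rmorphM rmorphB rmorphD !rmorphM fmorphV !rmorph_nat/=.
  rewrite -!/(p _ _) mulrBr !mulrA mulfV ?pnatr_eq0// !mul1r.
  have -> :
      (j == l)%:R * (p k j)^* + (l == k)%:R * (p j j)^* -
        (j == k)%:R * (p l j)^* -
        ((j == k)%:R * p l j + (k == l)%:R * p j j - (j == l)%:R * p k j) =
      (j == l)%:R * ((p k j)^* + p k j) - (j == k)%:R * ((p l j)^* + p l j) +
        (l == k)%:R * ((p j j)^* - p j j).
    by rewrite (eq_sym k l); ring.
  over.
have pick (F : 'I_n -> R[i]) i : \sum_j (j == i)%:R * F j = F i.
  rewrite (bigD1 i)//= eqxx mul1r big1 ?addr0// => j /negPf ->.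
  by rewrite mul0r.
rewrite big_split/= sumrB !pick mulr_sumr; congr (_ + _); ring.
Qed.

(** For [p = - 2^-1 S + s] with [S] real antisymmetric and [s] an imaginary scalar,
    [inner_sum_matrix] yields [S - n s] as matrix of the sum. Matching it with
    [m = S + t] forces [s = - t / n], that is [- t / 2 + (1 / 2 - 1 / n) t]. *)
Lemma real_basis_amenable n (e : 'I_n -> A) :
  real_basis ip sharp e -> ternary_weakly_amenable A.
Proof.
move=> ebasis delta ddelta _; have [eo _] := ebasis.
pose m l k : R[i] := delta (e k) (e l).
(* The coefficient [2^-1 - n%:R^-1] gives [phi j (e j)] the value [- t / n]. *)
pose phi j := - 2^-1 *: delta (e j) +
              ((2^-1 - n%:R^-1) * m j j) *: ip_dual spinA (e j).
exists n, e, phi => a.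
suff -> : delta = fun a => \sum_j inner_derivation (e j) (phi j) a by [].
apply: (conj_linear_eq_on_basis ebasis).
- exact: ternary_derivation_conj_linear ddelta.
- move=> k x y; rewrite scaler_sumr -big_split/=; apply: eq_bigr => j _.
  exact: inner_derivation_conj_linear.
move=> k l; have n0 : n%:R != 0 :> R[i].
  by rewrite pnatr_eq0 -lt0n (leq_ltn_trans _ (ltn_ord k)).
have pE i j :
    phi j (e i) = - 2^-1 * m i j + (2^-1 - n%:R^-1) * m j j * (i == j)%:R.
  by rewrite dualDE !dualZE ip_dualE eo.2.
have mdiag j : (m j j)^* = - m j j.
  exact: (derivation_matrix_diag spinA eo ddelta).
have pdiag j : phi j (e j) = - n%:R^-1 * m k k.
  have mkj : m k k = m j j.
    exact: (derivation_matrix_diag_const spinA eo ddelta).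
  by rewrite pE eqxx mulr1 mkj; ring.
have pdiag_conj j : (phi j (e j))^* = n%:R^-1 * m k k.
  by rewrite pdiag mulNr rmorphN rmorphM/= mdiag fmorphV rmorph_nat mulrN opprK.
apply: (@mulfI _ 2); first by rewrite pnatr_eq0.
rewrite inner_sum_matrix//; under eq_bigr do rewrite pdiag_conj pdiag.
rewrite sumr_const card_ord; have [->|lk] := eqVneq l k.
  by rewrite pdiag_conj pdiag -/(m k k) mulr1n mul1r -[_ *+ n]mulr_natr; field.
have [mlk mkl] : (m l k)^* = m l k /\ m k l = - m l k.
  exact: (derivation_matrix_offdiag spinA eo ddelta lk).
rewrite mul0r addr0 !pE (negPf lk) eq_sym (negPf lk) !mulr0 !addr0 -/(m l k).
rewrite !rmorphM rmorphN fmorphV rmorph_nat /= mkl rmorphN/= mlk.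
by field.
Qed.

End FiniteDimension.

(** * A derivation of an infinite dimensional spin factor *)

Section Rotation.
Variables (R : realType) (A : jbStarTripleType R).
Variables (ip : {dot A for Num.conj}) (sharp : A -> A).
Hypothesis spinA : spin_structure ip sharp.
Variable e : nat -> A.
Hypothesis e_orth : real_orthonormal ip sharp e.
Implicit Types (a b x : A) (k : R[i]).

Definition plane_rotation n a : A :=
  2^-1 ^+ n *: (ip a (e n.*2) *: e n.*2.+1 - ip a (e n.*2.+1) *: e n.*2).

(** The weights [2^-n] let the series converge in norm by completeness alone, from
    the crude bound [plane_rotation_norm] on its terms. *)
Definition rotation a : A := limn (series (plane_rotation^~ a)).

Lemma conj_half_exp n : (2^-1 ^+ n : R[i])^* = 2^-1 ^+ n.
Proof. by rewrite rmorphXn/= fmorphV rmorph_nat. Qed.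

Lemma plane_rotation_norm a n :
  `|plane_rotation n a| <= 4 * `|a| * 2^-1 ^+ n.
Proof.
have e1 i : `|e i| <= 1.
  by apply: (unit_norm_le1 spinA); rewrite e_orth.2 eqxx.
have term i j : `|ip a (e i) *: e j| <= 2 * `|a|.
  rewrite normrZ -[leRHS]mulr1 ler_pM// (le_trans (norm_ip_le spinA _ _))//.
  by rewrite ler_piMr// mulr_ge0.
have half0 : 0 <= (2^-1 : R[i]) ^+ n by rewrite exprn_ge0 ?invr_ge0 ?ler0n.
rewrite normrZ ger0_norm// mulrC ler_wpM2r//.
have -> : 4 * `|a| = 2 * `|a| + 2 * `|a| by ring.
by rewrite (le_trans (ler_normB _ _))// lerD.
Qed.

Lemma rotation_cvg a : series (plane_rotation^~ a) n @[n --> \oo] --> rotation a.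
Proof.
apply: (geometric_series_cvg (C := 4 * `|a|)); first by rewrite mulr_ge0.
exact: plane_rotation_norm.
Qed.

Lemma rotation_norm a : `|rotation a| <= 8 * `|a|.
Proof.
have -> : 8 * `|a| = 4 * `|a| * 2 by ring.
apply: geometric_series_norm; first by rewrite mulr_ge0.
exact: plane_rotation_norm.
Qed.

Lemma rotation_linear : linear rotation.
Proof.
move=> k a b; apply: cvg_lim => //.
have -> : series (plane_rotation^~ (k *: a + b)) =
    (fun n => k *: series (plane_rotation^~ a) n +
              series (plane_rotation^~ b) n).
  apply/funext => n; rewrite /series/= scaler_sumr -big_split/=.
  apply: eq_bigr => i _; rewrite /plane_rotation scalerA (mulrC k).
  rewrite -scalerA -scalerDr; congr (_ *: _).
  by rewrite !ipDl !ipZl !scalerDl opprD addrACA scalerBr !scalerA.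
by apply: cvgD; [apply: cvgZl_tmp|]; exact: rotation_cvg.
Qed.

Lemma ip_rotation_cvg a b :
  ip (series (plane_rotation^~ a) n) b @[n --> \oo] -->
  (ip (rotation a) b : R[i]^o).
Proof.
apply: (cvg_comp _ (ip_dual spinA b)); first exact: rotation_cvg.
exact: (@dual_continuous _ _ (ip_dual spinA b) (rotation a)).
Qed.

Lemma ip_rotation_skew a b : ip (rotation a) b = - ip a (rotation b).
Proof.
have skew n : ip (plane_rotation n a) b = - ip a (plane_rotation n b).
  rewrite ipZl ipZr conj_half_exp ipBl ipBr !ipZl !ipZr -!ipC.
  ring.
have := @ip_rotation_cvg a b.
have -> : (fun n => ip (series (plane_rotation^~ a) n) b) =
    (fun n => - (ip (series (plane_rotation^~ b) n) a)^*).
  apply/funext => n; rewrite /series/= -ipC ip_suml ip_sumr -sumrN.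
  by apply: eq_bigr.
rewrite (ipC ip a); move/cvg_lim => <- //; apply: cvg_lim => //.
apply: cvgN; apply: (cvg_comp _ Num.conj); first exact: ip_rotation_cvg.
exact: conj_continuous.
Qed.

Lemma sharp_continuous : continuous sharp.
Proof.
move=> x; apply/(@cvgrPdist_le _ _ _ (nbhs x)) => eps eps0; near=> y.
rewrite -(sharpB spinA) (sharp_isometry spinA).
by near: y; exact: (@cvgr_dist_le _ _ _ (nbhs x) _ id).
Unshelve. all: by end_near. Qed.

(** Real vectors are fixed by [sharp], so each partial sum commutes with it. *)
Lemma rotation_sharp a : rotation (sharp a) = sharp (rotation a).
Proof.
apply: cvg_lim => //.
have -> : series (plane_rotation^~ (sharp a)) =
    (fun n => sharp (series (plane_rotation^~ a) n)).
  apply/funext => n; rewrite /series/= (sharp_sum spinA); apply: eq_bigr => i _.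
  rewrite /plane_rotation (sharpZ spinA) conj_half_exp (sharpB spinA).
  rewrite !(sharpZ spinA) !e_orth.1.
  by rewrite !(ip_sharpl spinA) !e_orth.1.
by apply: (cvg_comp _ sharp); [exact: rotation_cvg|exact: sharp_continuous].
Qed.

(** The series is eventually constant: every term but the [n]-th kills
    [e n.*2]. *)
Lemma ip_rotation_even_odd n m :
  ip (rotation (e n.*2)) (e m.*2.+1) = (n == m)%:R * 2^-1 ^+ n.
Proof.
have step i : ip (plane_rotation i (e n.*2)) (e m.*2.+1) =
    if i == n then (n == m)%:R * 2^-1 ^+ n else 0.
  have odd_even p q : (p.*2 == q.*2.+1) = false by apply/negP => /eqP; lia.
  rewrite ipZl ipBl !ipZl !e_orth.2 odd_even mul0r subr0 eqSS !(inj_eq double_inj).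
  rewrite eq_sym; case: eqVneq => [->|_]; rewrite ?mul1r ?mul0r ?mulr0//.
  by rewrite mulrC.
have := @ip_rotation_cvg (e n.*2) (e m.*2.+1); move/cvg_lim => <- //.
apply: cvg_lim => //; apply: cvg_near_cst; exists n.+1 => // N /= nN.
rewrite /series/= ip_suml; under eq_bigr do rewrite step.
by rewrite big_mkord -big_mkcond/= (big_pred1 (Ordinal nN)).
Qed.

End Rotation.

(** * Inner derivations have blocks of bounded rank *)

Section SkewDerivation.
Variables (R : realType) (A : jbStarTripleType R).
Variables (ip : {dot A for Num.conj}) (sharp : A -> A).
Hypothesis spinA : spin_structure ip sharp.

(** In the derivation identity, skewness cancels the terms in which [D] meets
    one argument inside [ip], and commutation with [sharp] does so for the terms
    that involve [sharp]. *)
Lemma skew_ternary_derivation (D : A -> A) : linear D ->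
  (forall a b, ip (D a) b = - ip a (D b)) ->
  (forall a, D (sharp a) = sharp (D a)) ->
  ternary_derivation (fun a => ip_dual spinA (D a)).
Proof.
move=> Dlin skew Dsharp; split=> [k a b|a b c].
  by apply: dualP => x; rewrite dualDE dualZE !ip_dualE Dlin ipDr ipZr.
have D0 : D 0 = 0.
  by have := Dlin (-1) 0 0; rewrite scaler0 addr0 scaleN1r addNr.
have DD x y : D (x + y) = D x + D y by have := Dlin 1 x y; rewrite !scale1r.
have DZ k x : D (k *: x) = k *: D x by have := Dlin k x 0; rewrite D0 !addr0.
have DB x y : D (x - y) = D x - D y by rewrite -scaleN1r DD DZ scaleN1r.
apply: dualP => x; rewrite 2!dualDE /= !(spin_tprod spinA).
rewrite DZ DB DD !DZ Dsharp !ipZr !ipBr !ipDr !ipZr !ipZl !ipBl !ipDl !ipZl.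
have swap u v : ip u (D v) = - (ip v (D u))^* by rewrite -ipC skew opprK.
have swap_sharp : ip (sharp a) (D c) = - ip (sharp c) (D a).
  by rewrite swap Dsharp (ip_sharpl spinA c).
rewrite swap_sharp (swap b a) (swap b c) (ip_sharpl spinA x).
rewrite (ipC ip b c) (ipC ip x c) (ipC ip b a) (ipC ip x a).
rewrite !rmorphM !rmorphB !rmorphD !rmorphM/= conjCK.
rewrite fmorphV rmorph_nat; ring.
Qed.

(** For orthogonal [a] and [x] the scalar part of the inner derivation drops out,
    leaving four products of a factor in [a] by a factor in [x]. *)
Lemma inner_derivation_real (b a x : A) (phi : dualspace A) :
  sharp a = a -> sharp x = x -> ip a x = 0 ->
  inner_derivation b phi a x =
  2^-1 * (ip x b * (phi a)^* - ip a b * (phi x)^* - ip b a * phi x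
          + ip b x * phi a).
Proof.
move=> ar xr ax; have xa : ip x a = 0 by rewrite (ipC ip) ax rmorph0.
rewrite inner_derivationE !(spin_tprod spinA) ar xr ax xa !scale0r !addr0.
rewrite !dualZ !dualB !dualZ rmorphM rmorphB !rmorphM fmorphV rmorph_nat/=.
by rewrite -!ipC; ring.
Qed.

(** Each of the four products in [inner_derivation_real], summed over [j], is a
    matrix factoring through dimension [m]. *)
Lemma inner_block_rank_le (m N : nat) (b : 'I_m -> A)
    (phi : 'I_m -> dualspace A) (x a : 'I_N -> A) :
  (forall k, sharp (x k) = x k) -> (forall k, sharp (a k) = a k) ->
  (forall k l, ip (a k) (x l) = 0) ->
  (\rank (\matrix_(k, l)
     (\sum_j inner_derivation (b j) (phi j) (a l)) (x k))%R <= 4 * m)%N.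
Proof.
move=> xr ar ax.
pose X1 : 'M[R[i]]_(N, m) := \matrix_(k, j) ip (x k) (b j).
pose Y1 : 'M[R[i]]_(m, N) := \matrix_(j, l) (2^-1 * (phi j (a l))^*).
pose X2 : 'M[R[i]]_(N, m) := \matrix_(k, j) (phi j (x k))^*.
pose Y2 : 'M[R[i]]_(m, N) := \matrix_(j, l) (- 2^-1 * ip (a l) (b j)).
pose X3 : 'M[R[i]]_(N, m) := \matrix_(k, j) (phi j (x k)).
pose Y3 : 'M[R[i]]_(m, N) := \matrix_(j, l) (- 2^-1 * ip (b j) (a l)).
pose X4 : 'M[R[i]]_(N, m) := \matrix_(k, j) ip (b j) (x k).
pose Y4 : 'M[R[i]]_(m, N) := \matrix_(j, l) (2^-1 * phi j (a l)).
have -> :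
    \matrix_(k, l) (\sum_j inner_derivation (b j) (phi j) (a l)) (x k) =
    X1 *m Y1 + X2 *m Y2 + X3 *m Y3 + X4 *m Y4.
  apply/matrixP => k l; rewrite !mxE -!big_split/= dual_sumE.
  by apply: eq_bigr => j _; rewrite inner_derivation_real// !mxE; ring.
have rk (X : 'M[R[i]]_(N, m)) (Y : 'M[R[i]]_(m, N)) : (\rank (X *m Y) <= m)%N.
  exact: leq_trans (mxrankM_maxl X Y) (rank_leq_col X).
apply: leq_trans (mxrank_add _ _) _; rewrite mulSnr leq_add//.
apply: leq_trans (mxrank_add _ _) _; rewrite mulSnr leq_add//.
by apply: leq_trans (mxrank_add _ _) _; rewrite mulSnr mul1n leq_add.
Qed.

(** The block of size [4 m + 1] of [rotation] is invertible, one rank more than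
    [m] inner derivations can reach. *)
Lemma real_sequence_not_amenable (e : nat -> A) :
  real_orthonormal ip sharp e -> ~ ternary_weakly_amenable A.
Proof.
move=> eo amen; pose D := rotation ip e.
pose delta a := ip_dual spinA (D a).
have ddelta : ternary_derivation delta.
  apply: skew_ternary_derivation.
  - exact: (rotation_linear spinA eo).
  - exact: (ip_rotation_skew spinA eo).
  - exact: (rotation_sharp spinA eo).
have dcont : continuous delta.
  move=> x; apply/(@cvgrPdist_le _ _ _ (nbhs x)) => eps eps0; near=> y.
  rewrite -(conj_linearB (ternary_derivation_conj_linear ddelta)).
  rewrite (le_trans (ip_dual_norm _ _))//.
  rewrite (@le_trans _ _ (16 * `|x - y|))//.
    have -> : 16 * `|x - y| = 2 * (8 * `|x - y|) by ring.
    by rewrite ler_wpM2l// (rotation_norm spinA eo).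
  rewrite -ler_pdivlMl// mulrC.
  near: y; apply: (@cvgr_dist_le _ _ _ (nbhs x) _ id) => //.
  by rewrite divr_gt0.
have [m [b [phi deltaE]]] := amen delta ddelta dcont.
pose N := (4 * m).+1.
have [er oe] := eo.
have := @inner_block_rank_le m N b phi (fun k => e k.*2.+1) (fun l => e l.*2).
have -> : \matrix_(k < N, l < N)
      (\sum_j inner_derivation (b j) (phi j) (e l.*2)) (e k.*2.+1) =
    diag_mx (\row_(k < N) 2^-1 ^+ k).
  apply/matrixP => k l; rewrite !mxE -deltaE ip_dualE (ipC ip).
  rewrite (ip_rotation_even_odd spinA eo)// rmorphM rmorph_nat/= conj_half_exp.
  by rewrite mulr_natl (inj_eq val_inj) (eq_sym l); case: eqVneq => [->|].
rewrite mxrank_unit ?ltnn => [|]; last first.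
  rewrite unitmxE det_diag unitfE; apply/prodf_neq0 => k _.
  by rewrite mxE expf_neq0// invr_eq0 pnatr_eq0.
move=> rk; suff: false by []. apply: rk => // k l; rewrite oe.
by case: eqP => //; lia.
Unshelve. all: by end_near. Qed.

End SkewDerivation.

Theorem proposition5p10 (R : realType) (A : jbStarTripleType R)
    (hA : spin_factor A) :
  ternary_weakly_amenable A <-> finite_dimensional A.
Proof.
have [ip [sharp spinA]] := hA.
have [[n [e ebasis]]|[e eo]] := real_basis_or_sequence spinA.
  split=> _; first exact: (real_basis_finite_dimensional ebasis).
  exact: (real_basis_amenable spinA ebasis).
split=> [/(real_sequence_not_amenable spinA eo)//|].
by move=> /(real_sequence_not_finite_dimensional eo).
Qed.
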